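(* Let $\varepsilon>0$ be fixed, and let $p=p(n)$ satisfy $(1+\varepsilon)\log n/n \le p \le 1-\varepsilon$. Let $G\in G(n,p)$. Then there exists a constant $C=C(\varepsilon)>0$ such that asymptotically almost surely (i.e. with probability tending to $1$ as $n\to\infty$) $G$ is connected and $$\mathcal{AC}(G)\le C\,\frac{\log n}{p}.$$
   Context: $G(n,p)$ denotes the binomial random graph on vertex set $\{1,\dots,n\}$ in which each of the $\binom n2$ pairs is an edge independently with probability $p$. Acquaintance time: let $G$ be a finite connected graph. Initially one agent is placed on each vertex. Two agents are declared acquainted (permanently) whenever they occupy adjacent vertices at some point of the process (in particular, agents on adjacent vertices at the start are acquainted). In each round one chooses a matching $M$ of $G$ (any matching, possibly a single edge) and swaps the agents on the two endpoints of each edge of $M$. The acquaintance time $\mathcal{AC}(G)$ is the minimum number of rounds needed until every pair of agents has become acquainted. $\log$ denotes the natural logarithm. *)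

(* Defs.v *)
From HB Require Import structures.
From mathcomp Require Import all_boot all_order all_algebra.
From mathcomp Require Import all_classical all_reals all_analysis.

Set Implicit Arguments.
Unset Strict Implicit.
Unset Printing Implicit Defensive.

Import Order.TTheory GRing.Theory Num.Theory.
Import numFieldNormedType.Exports.

Local Open Scope classical_set_scope.
Local Open Scope ring_scope.

(* A simple graph on [T] is its edge set [G : {set {set T}}], subject to
   [G \subset pairs T]. *)
Section Graphs.
Variable T : finType.
Implicit Types (G M : {set {set T}}) (Ms : seq {set {set T}}).

Definition pairs : {set {set T}} := [set e : {set T} | #|e| == 2%N]%SET.

Definition adj G : rel T := fun x y => ([set x; y] \in G)%SET.

Definition connected_graph G : bool :=
  [forall x, forall y, connect (adj G) x y].

Definition matching G M : bool := (M \subset G) && finset.trivIset M.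

(* [matching_swap M x] is where the agent standing on [x] stands after the
   swaps along [M]. *)
Definition matching_swap M (x : T) : T :=
  odflt x [pick y | adj M x y].

(* Agents are named after their initial vertices; the rounds of [Ms] are
   performed from left to right. *)
Definition position Ms (a : T) : T :=
  foldl (fun x M => matching_swap M x) a Ms.

Definition acquainted G Ms (a b : T) : Prop :=
  exists2 t : nat, (t <= size Ms)%N &
    adj G (position (take t Ms) a) (position (take t Ms) b).

Definition acquainting_strategy G Ms : Prop :=
  all (matching G) Ms /\ forall a b : T, a != b -> acquainted G Ms a b.

(* The infimum of a set of natural numbers is its minimum, except that it is
   [+oo] when no strategy exists. *)
Definition acquaintance_time (R : realType) G : \bar R :=
  ereal_inf [set ((size Ms)%:R)%:E | Ms in acquainting_strategy G].

End Graphs.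

(* The probability that [G(n, p)] satisfies [A]. *)
Definition gnp_prob (R : realType) (n : nat) (p : R)
    (A : pred {set {set 'I_n}}) : R :=
  \sum_(G : {set {set 'I_n}} | (G \subset pairs 'I_n) && A G)
    \prod_(e in pairs 'I_n) (if e \in G then p else 1 - p).

(* Main.v *)
(* [G(n, p)] is exposed in two rounds, as the union of independent [G(n, q)] and
   [G(n, r)] with [q = c p], [c] small. Depth-first search in the first round
   yields a path missing only a small proportion of the vertices. Given the path,
   the second round contains a matching of the missing vertices into the path,
   found greedily: each vertex chooses among almost [n] unexposed pairs, hence
   fails with probability at most [n^-(1 + eps/4)].

   The agents on the path are circulated by alternately swapping its even and
   its odd edges, for [k ~ 16 ln n / p] rounds. If [k] exceeds twice the length
   of the path, every agent of the path meets everybody. Otherwise such an agent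
   and any other one face each other across at least [k / 4] distinct pairs of
   vertices, so that the second round acquaints them except with probability
   [exp(- r k / 4)], which is small compared with [n^-2]. Finally the missing
   agents are swapped onto the path along the matching, and the agents on the
   path circulate again. *)
Require Import Defs.
From HB Require Import structures.
From mathcomp Require Import all_boot all_order all_algebra.
From mathcomp Require Import all_classical all_reals all_analysis.
From mathcomp Require Import zify ring lra.

Set Implicit Arguments.
Unset Strict Implicit.
Unset Printing Implicit Defensive.

Import Order.TTheory GRing.Theory Num.Theory.
Import numFieldNormedType.Exports.

(** * Strategies along a path *)

Section GraphLemmas.
Import mathcomp.boot.finset mathcomp.boot.fintype.
Local Open Scope set_scope.
Variable T : finType.
Implicit Types (G M : {set {set T}}) (Ms : seq {set {set T}}) (s : seq T).

Lemma adj_sym G : symmetric (adj G).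
Proof. by move=> x y; rewrite /adj setUC. Qed.

Lemma adj_sub G1 G2 x y : G1 \subset G2 -> adj G1 x y -> adj G2 x y.
Proof. by move=> /subsetP sub /sub. Qed.

(** Encodes an involution as a matching, so that a round can be given by the motion it causes. Fixed
    points are left out because [[set x; x]] is not a pair. *)
Definition swap_edges (f : T -> T) : {set {set T}} :=
  [set [set x; f x] | x in [set x | f x != x]].

Section SwapEdges.
Variables (G : {set {set T}}) (f : T -> T).
Hypotheses (fK : involutive f) (fG : forall x, f x != x -> adj G x (f x)).

Lemma adj_swap_edges x y : f x != x -> adj (swap_edges f) x y = (y == f x).
Proof.
move=> fx; apply/imsetP/eqP => [[z]|->]; last by exists x; rewrite ?inE.
rewrite inE => fz eqxy.
have [xz|xz] : x = z \/ x = f z.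
  by have := set21 x y; rewrite eqxy => /set2P.
- subst z; have : f x \in [set x; y] by rewrite eqxy set22.
  by rewrite !inE (negPf fx) /= => /eqP.
- subst x; rewrite fK in fx *.
  have : z \in [set f z; y] by rewrite eqxy set21.
  by rewrite !inE (negPf fx) => /eqP.
Qed.

Lemma adj_swap_edges_fix x y : f x = x -> adj (swap_edges f) x y = false.
Proof.
move=> fx; apply/imsetP => -[z]; rewrite inE => fz eqxy.
have : x \in [set z; f z] by rewrite -eqxy set21.
rewrite !inE => /orP[] /eqP xz; subst x; first by rewrite fx eqxx in fz.
by rewrite fK in fx; rewrite -fx eqxx in fz.
Qed.

Lemma matching_swap_edges x : matching_swap (swap_edges f) x = f x.
Proof.
rewrite /matching_swap; case: (eqVneq (f x) x) => [fx|fx].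
  by case: pickP => [y|] //=; rewrite adj_swap_edges_fix.
case: pickP => [y|/(_ (f x))] /=; rewrite adj_swap_edges //.
  by move/eqP.
by rewrite eqxx.
Qed.

Lemma swap_edges_matching : matching G (swap_edges f).
Proof.
apply/andP; split.
  by apply/subsetP => _ /imsetP[x + ->]; rewrite inE => /fG.
apply/trivIsetP => _ _ /imsetP[x _ ->] /imsetP[y _ ->] neq.
apply/pred0P => z /=; apply/negP => /andP[]; rewrite !inE => zx zy.
move/negP: neq; apply.
have key (w : T) : z = w \/ z = f w -> [set w; f w] = [set z; f z].
  by case=> ->; rewrite ?fK // setUC.
rewrite (key x) ?(key y) //.
  by case/orP: zy => /eqP ->; [left|right].
by case/orP: zx => /eqP ->; [left|right].
Qed.

End SwapEdges.

Lemma position_rcons Ms M a :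
  position (rcons Ms M) a = matching_swap M (position Ms a).
Proof. by rewrite /position foldl_rcons. Qed.

Lemma position_cat Ms1 Ms2 a :
  position (Ms1 ++ Ms2) a = position Ms2 (position Ms1 a).
Proof. by rewrite /position foldl_cat. Qed.

Lemma acquainted_catl G Ms1 Ms2 a b :
  acquainted G Ms1 a b -> acquainted G (Ms1 ++ Ms2) a b.
Proof.
case=> t tle adjab; exists t; first by rewrite size_cat (leq_trans tle) ?leq_addr.
by rewrite takel_cat.
Qed.

Lemma acquainted_catr G Ms1 Ms2 a b :
  acquainted G Ms2 (position Ms1 a) (position Ms1 b) ->
  acquainted G (Ms1 ++ Ms2) a b.
Proof.
case=> t tle adjab; exists (size Ms1 + t); first by rewrite size_cat leq_add2l.
by rewrite takeD take_size_cat ?drop_size_cat // !position_cat.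
Qed.

Lemma acquainted_sym G Ms a b : acquainted G Ms a b -> acquainted G Ms b a.
Proof. by case=> t tle ab; exists t => //; rewrite adj_sym. Qed.

(** Round [t] pairs each position of the parity of [t] with its successor. An agent without a
    partner waits at its end of the path: the last position is caught by the test [i.+1 < m], the
    first by [0.-1 = 0]. *)
Definition ladder (m t i : nat) : nat :=
  if odd i == odd t then (if i.+1 < m then i.+1 else i) else i.-1.

Definition path_swap s t (x : T) : T :=
  if x \in s then nth x s (ladder (size s) t (index x s)) else x.

Definition path_rounds s k : seq {set {set T}} :=
  mkseq (fun t => swap_edges (path_swap s t)) k.

Lemma ladder_lt m t i : i < m -> ladder m t i < m.
Proof. by rewrite /ladder; case: ifP => _; [case: ifP|]; lia. Qed.

Lemma ladderK m t i : i < m -> ladder m t (ladder m t i) = i.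
Proof.
by rewrite /ladder => im; repeat case: ifP; lia.
Qed.

Section PathSwap.
Variables (s : seq T) (us : uniq s).

Lemma path_swap_nth x0 t i : i < size s ->
  path_swap s t (nth x0 s i) = nth x0 s (ladder (size s) t i).
Proof.
move=> im; rewrite /path_swap mem_nth // index_uniq //.
by apply: set_nth_default; rewrite ladder_lt.
Qed.

Lemma path_swapK t : involutive (path_swap s t).
Proof.
move=> x; case: (boolP (x \in s)) => xs; last first.
  by rewrite /path_swap (negPf xs) (negPf xs).
have ix : index x s < size s by rewrite index_mem.
by rewrite -(nth_index x xs) !path_swap_nth ?ladder_lt // ladderK.
Qed.

Lemma path_swap_adj G t x : sorted (adj G) s ->
  path_swap s t x != x -> adj G x (path_swap s t x).
Proof.
move=> ss; case: (boolP (x \in s)) => xs; last first.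
  by rewrite /path_swap (negPf xs) eqxx.
have ix : index x s < size s by rewrite index_mem.
have adjS i : i.+1 < size s -> adj G (nth x s i) (nth x s i.+1).
  by move=> im; apply: (sortedP x ss).
rewrite -(nth_index x xs) path_swap_nth //.
move: (index x s) ix => i im; rewrite /ladder.
case: ifP => _; first by case: ifP => [h _|]; [exact: adjS|rewrite eqxx].
case: i im => [|i] im /=; first by rewrite eqxx.
by move=> _; rewrite adj_sym adjS.
Qed.

Lemma path_rounds_matching G k : sorted (adj G) s ->
  all (matching G) (path_rounds s k).
Proof.
move=> ss; apply/allP => _ /mapP[t _ ->].
apply: swap_edges_matching; first exact: path_swapK.
by move=> x; apply: path_swap_adj.
Qed.

Lemma position_path_roundsS t a :
  position (path_rounds s t.+1) a = path_swap s t (position (path_rounds s t) a).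
Proof.
by rewrite /path_rounds mkseqS position_rcons matching_swap_edges //; exact: path_swapK.
Qed.

Lemma take_path_rounds k t : t <= k -> take t (path_rounds s k) = path_rounds s t.
Proof.
by move=> tk; rewrite /path_rounds /mkseq -map_take take_iota (minn_idPl tk).
Qed.

Lemma position_path_rounds_notin t a : a \notin s ->
  position (path_rounds s t) a = a.
Proof.
move=> a_s; elim: t => [//|t IH].
by rewrite position_path_roundsS IH /path_swap (negPf a_s).
Qed.

(* Reflecting the path at its ends turns the motion of every agent into a
   translation of the cycle of length [2 m]; [fold m] projects two turns of
   this cycle back onto the path, and [unfold m i] is the starting point above
   [i] from which the walk moves in the right direction. *)
Definition fold (m y : nat) : nat :=
  if y < m then y else if y < 2 * m then 2 * m - 1 - y
  else if y < 3 * m then y - 2 * m else 4 * m - 1 - y.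

Definition unfold (m i : nat) : nat := if odd i then 2 * m - 1 - i else i.

Lemma fold_lt m y : y < 4 * m -> fold m y < m.
Proof. rewrite /fold; repeat case: ifP; lia. Qed.

Lemma unfold_lt m i : i < m -> unfold m i < 2 * m.
Proof. by rewrite /unfold; case: ifP; lia. Qed.

Lemma unfold_even m i : i < m -> odd (unfold m i) = false.
Proof. by rewrite /unfold; case: ifP; lia. Qed.

Lemma unfold_inj m i j : i < m -> j < m -> unfold m i = unfold m j -> i = j.
Proof. by rewrite /unfold; do 2!case: ifP; lia. Qed.

Lemma fold_unfold m i : i < m -> fold m (unfold m i) = i.
Proof. by rewrite /unfold /fold; repeat case: ifP; lia. Qed.

(** On an ascending half of the cycle [fold m y] has the parity of [y], so that [ladder] steps up;
    on a descending half the parity is opposite and it steps down. As [unfold] is even, a walk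
    started there keeps the parity of [t]. *)
Lemma ladder_fold m t y : odd y = odd t -> y.+1 < 4 * m ->
  ladder m t (fold m y) = fold m y.+1.
Proof. by rewrite /ladder /fold; repeat case: ifP; lia. Qed.

Lemma position_path_rounds x0 i t : i < size s -> t <= 2 * size s ->
  position (path_rounds s t) (nth x0 s i) =
  nth x0 s (fold (size s) (unfold (size s) i + t)).
Proof.
move=> im; have um := unfold_lt im; have ue := unfold_even im.
elim: t => [_|t IH tm]; first by rewrite addn0 fold_unfold.
rewrite position_path_roundsS IH; last exact: ltnW.
rewrite path_swap_nth; last by apply: fold_lt; lia.
by rewrite ladder_fold ?addnS //; [rewrite oddD ue|lia].
Qed.

Lemma position_path_rounds_inj t : injective (position (path_rounds s t)).
Proof.
elim: t => [//|t IH] a b; rewrite !position_path_roundsS.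
by move/(inv_inj (path_swapK t))/IH.
Qed.

(** Both points advance at the same speed until their midpoint [h + t] is [m - 1] or [2 * m - 1].
    The axis of the folding lies half a step further, so points symmetric about the midpoint fold to
    neighbouring positions. *)
Lemma fold_meet m x y : x < 2 * m -> y < 2 * m -> odd x = false ->
  odd y = false -> x != y ->
  exists2 t, t < m & fold m (x + t) = (fold m (y + t)).+1 \/
                     fold m (y + t) = (fold m (x + t)).+1.
Proof.
move=> xm ym ex ey xy.
pose h := (x + y)./2.
have hE : x + y = 2 * h by rewrite /h; lia.
exists (if h <= m - 1 then m - 1 - h else 2 * m - 1 - h).
  by case: ifP; lia.
by case: ifP => hm; rewrite /fold; repeat case: ifP; lia.
Qed.

Lemma path_rounds_meet G k a b : sorted (adj G) s -> a \in s -> b \in s ->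
  a != b -> 2 * size s < k -> acquainted G (path_rounds s k) a b.
Proof.
move=> ss a_s b_s ab km.
have ia : index a s < size s by rewrite index_mem.
have ib : index b s < size s by rewrite index_mem.
have [t tm meet] : exists2 t, t < size s &
    fold (size s) (unfold (size s) (index a s) + t) =
      (fold (size s) (unfold (size s) (index b s) + t)).+1 \/
    fold (size s) (unfold (size s) (index b s) + t) =
      (fold (size s) (unfold (size s) (index a s) + t)).+1.
  apply: fold_meet; rewrite ?unfold_lt ?unfold_even //.
  apply: contra ab => /eqP /(unfold_inj ia ib) e.
  by rewrite -(nth_index a a_s) e nth_index.
exists t; first by rewrite size_mkseq; lia.
rewrite take_path_rounds; last by lia.
rewrite -{1}(nth_index a a_s) -(nth_index a b_s) !position_path_rounds //; try lia.
have la : fold (size s) (unfold (size s) (index a s) + t) < size s.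
  by apply: fold_lt; have := unfold_lt ia; lia.
have lb : fold (size s) (unfold (size s) (index b s) + t) < size s.
  by apply: fold_lt; have := unfold_lt ib; lia.
case: meet => e; first rewrite adj_sym.
all: by rewrite e; apply: (sortedP a ss); rewrite -e.
Qed.

Lemma path_rounds_visit k a v : a \in s -> v \in s -> 2 * size s < k ->
  exists2 t, t <= k & position (path_rounds s t) a = v.
Proof.
move=> a_s v_s km.
have ia : index a s < size s by rewrite index_mem.
have iv : index v s < size s by rewrite index_mem.
have ua := unfold_lt ia.
(* The walk is stopped at the first of the lifts [index v s] and [index v s + 2 * size s] of [v]
   that is not behind its start; this takes at most one full turn. *)
exists (if unfold (size s) (index a s) <= index v s
        then index v s - unfold (size s) (index a s)
        else index v s + 2 * size s - unfold (size s) (index a s)).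
  by case: ifP; lia.
rewrite -[X in position _ X](nth_index a a_s).
rewrite position_path_rounds //; last by case: ifP; lia.
rewrite -[RHS](nth_index a v_s); congr nth.
by case: ifP => h; rewrite /fold; repeat case: ifP; lia.
Qed.

(** The schedule depends on the path alone, so this set is already fixed when the second round of
    edges is exposed. *)
Definition trace k a b : {set {set T}} :=
  [set [set position (path_rounds s t) a; position (path_rounds s t) b] | t : 'I_k].

Lemma trace_pairs k a b : a != b -> trace k a b \subset pairs T.
Proof.
move=> ab; apply/subsetP => _ /imsetP[t _ ->].
by rewrite inE cards2 (inj_eq (@position_path_rounds_inj t)) ab.
Qed.

Lemma trace_acquainted G k a b : G :&: trace k a b != set0 ->
  acquainted G (path_rounds s k) a b.
Proof.
case/set0Pn => e /setIP[+ /imsetP[t _ eE]]; rewrite eE => adjab.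
exists t; first by rewrite size_mkseq ltnW.
by rewrite take_path_rounds // ltnW.
Qed.

(* The cycle of length [2 m] covers every vertex of the path twice, and an edge
   has two ends. *)
Lemma card_trace k a b : a \in s -> k <= 2 * size s ->
  k <= 4 * #|trace k a b|.
Proof.
move=> a_s km.
have ia : index a s < size s by rewrite index_mem.
have ua := unfold_lt ia.
set u := unfold (size s) (index a s) in ua.
(* The boolean records whether the lifted point is on an ascending half. With the position it
   determines [u + t] modulo [2 * size s], hence [t], as [k <= 2 * size s]. *)
pose g (t : 'I_k) := (position (path_rounds s t) a,
  (u + t < size s) || (2 * size s <= u + t) && (u + t < 3 * size s)).
have g_inj : injective g.
  move=> t1 t2 [] /eqP.
  have l1 := ltn_ord t1; have l2 := ltn_ord t2.
  rewrite -{1 2}(nth_index a a_s) !position_path_rounds //; try lia.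
  rewrite -/u nth_uniq //; try by apply: fold_lt; lia.
  move=> /eqP e1 e2; apply/val_inj => /=; move: e1 e2.
  by rewrite /fold; repeat case: ifP; lia.
have le1 : k <= #|cover (trace k a b)| * 2.
  rewrite -[k in k <= _]card_ord -cardsT -(card_imset _ g_inj).
  rewrite -card_bool -[X in _ * X]cardsT -cardsX; apply: subset_leq_card.
  apply/subsetP => _ /imsetP[t _ ->]; rewrite !inE andbT.
  apply/bigcupP; exists [set position (path_rounds s t) a; position (path_rounds s t) b].
    by apply/imsetP; exists t.
  by rewrite set21.
apply: leq_trans le1 _.
have [cov _] := leq_card_cover (trace k a b).
suff : \sum_(A in trace k a b) #|A| <= #|trace k a b| * 2 by lia.
rewrite -sum_nat_const; apply: leq_sum => _ /imsetP[t _ ->].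
by rewrite cards2; case: (_ != _).
Qed.

End PathSwap.

Lemma sorted_connect G s x y : sorted (adj G) s -> x \in s -> y \in s ->
  connect (adj G) x y.
Proof.
have cs : connect_sym (adj G) by apply: sym_connect_sym; exact: adj_sym.
case: s => [//|z s] /= ss.
have zc w : w \in z :: s -> connect (adj G) z w by apply: path_connect.
by move=> /zc xs /zc ys; rewrite (connect_trans _ ys) // cs.
Qed.

(** * Vertices matched into the path *)

Definition attaches G s (f : T -> T) : Prop :=
  {in [predC s] &, injective f} /\
  forall x, x \notin s -> (f x \in s) && adj G x (f x).

Section Attached.
Variables (G : {set {set T}}) (s : seq T) (f : T -> T).
Hypotheses (us : uniq s) (ss : sorted (adj G) s) (fP : attaches G s f).

Lemma attached_connected : connected_graph G.
Proof.
have cs : connect_sym (adj G) by apply: sym_connect_sym; exact: adj_sym.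
have toP x : exists2 y, y \in s & connect (adj G) x y.
  case: (boolP (x \in s)) => xs; first by exists x.
  by have /andP[fs xf] := fP.2 x xs; exists (f x) => //; apply: connect1.
apply/forallP => x; apply/forallP => y.
have [x' x's xx'] := toP x; have [y' y's yy'] := toP y.
apply: connect_trans xx' _; rewrite cs.
by apply: connect_trans yy' _; exact: sorted_connect ss y's x's.
Qed.

(** Extends the matching [f] to an involution: a path vertex returns to its outer partner, or stays
    put if it has none. *)
Definition attach_swap (x : T) : T :=
  if x \in s then odflt x [pick y | (y \notin s) && (f y == x)] else f x.

Lemma attach_swap_image x : x \notin s -> attach_swap (f x) = x.
Proof.
move=> xs; have /andP[fs _] := fP.2 x xs.
rewrite /attach_swap fs; case: pickP => [y /andP[ys /eqP]|/(_ x)] /=.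
  by apply: fP.1; rewrite inE.
by rewrite xs eqxx.
Qed.

Lemma attach_swapK : involutive attach_swap.
Proof.
move=> x; case: (boolP (x \in s)) => xs; last first.
  by rewrite {2}/attach_swap (negPf xs) attach_swap_image.
rewrite {2}/attach_swap xs; case: pickP => [y /andP[ys /eqP <-]|none] /=.
  by rewrite /attach_swap (negPf ys).
by rewrite /attach_swap xs; case: pickP => [y|]//; rewrite none.
Qed.

Lemma attach_swap_adj x : attach_swap x != x -> adj G x (attach_swap x).
Proof.
rewrite /attach_swap; case: (boolP (x \in s)) => xs; last first.
  by case/andP: (fP.2 x xs).
case: pickP => [y /andP[ys /eqP <-] _|_] /=; last by rewrite eqxx.
by rewrite adj_sym; case/andP: (fP.2 y ys).
Qed.

(* A run along the path acquaints its vertices with everybody; a second one,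
   after the outer agents have been swapped onto the path, does the rest. *)
Lemma attached_strategy k :
  (forall a b, a \in s -> a != b -> acquainted G (path_rounds s k) a b) ->
  acquainting_strategy G
    (path_rounds s k ++ swap_edges attach_swap :: path_rounds s k).
Proof.
move=> acq; split.
  rewrite all_cat /= path_rounds_matching // swap_edges_matching //.
    exact: attach_swapK.
  exact: attach_swap_adj.
move=> a b ab; case: (boolP (a \in s)) => a_s.
  by apply: acquainted_catl; exact: acq.
case: (boolP (b \in s)) => b_s.
  by apply: acquainted_catl; apply: acquainted_sym; apply: acq; rewrite // eq_sym.
(* Neither outer agent moves during the first run. The swap then brings [a] onto the path, and the
   hypothesis applies to the vertices occupied at the start of the second run. *)
rewrite -cat_rcons; apply: acquainted_catr.
rewrite !position_rcons !position_path_rounds_notin //.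
rewrite !matching_swap_edges; try exact: attach_swapK.
apply: acq; last by rewrite (inj_eq (inv_inj attach_swapK)).
by rewrite /attach_swap (negPf a_s); case/andP: (fP.2 a a_s).
Qed.

(** An agent off the path waits at its vertex [b], while [a], making a full turn, passes through the
    neighbour [f b] of that vertex. *)
Lemma path_rounds_acquainted k a b : G \subset pairs T -> a \in s -> a != b ->
  2 * size s < k -> acquainted G (path_rounds s k) a b.
Proof.
move=> GP a_s ab km; case: (boolP (b \in s)) => b_s.
  exact: path_rounds_meet.
have /andP[fs bf] := fP.2 b b_s.
have [t tk pos] := path_rounds_visit us a_s fs km.
exists t; first by rewrite size_mkseq.
by rewrite take_path_rounds // pos position_path_rounds_notin // adj_sym.
Qed.

End Attached.

(* Depth-first search, with explored vertices [A], stack [s] and unvisited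
   vertices [B]: [#|B| - #|A|] drops by exactly one at each step, so it has to
   vanish at some point. *)
Lemma dfs_balanced_split G (s : seq T) (A B : {set T}) :
  uniq s -> sorted (adj G) s ->
  (forall x, [|| x \in A, x \in B | x \in s]) ->
  [disjoint A & B] -> [disjoint A & s] -> [disjoint B & s] ->
  (forall x y, x \in A -> y \in B -> ~~ adj G x y) -> #|A| <= #|B| ->
  exists s' (A' B' : {set T}), [/\ uniq s', sorted (adj G) s',
    [disjoint A' & B'], #|A'| = #|B'| &
    (forall x y, x \in A' -> y \in B' -> ~~ adj G x y) /\
    [set x | x \notin s'] = A' :|: B'].
Proof.
(* Pushing a vertex of [B] changes this measure by [-2 + 1], popping one from the stack by [-1]. *)
have [N] := ubnP (2 * #|B| + size s).
elim: N s A B => [//|N IH] s A B leN us ss cov dAB dAs dBs noE leAB.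
have [eqAB|neAB] := eqVneq #|A| #|B|.
  exists s, A, B; split => //; split => //.
  apply/setP => x; rewrite !inE; have := cov x.
  case: (boolP (x \in s)) => xs.
    by rewrite (disjointFl dAs xs) (disjointFl dBs xs).
  by rewrite orbF.
have ltAB : #|A| < #|B| by rewrite ltn_neqAle neAB.
have push y : y \in B -> sorted (adj G) (y :: s) -> exists s' (A' B' : {set T}),
    [/\ uniq s', sorted (adj G) s', [disjoint A' & B'], #|A'| = #|B'| &
    (forall x y, x \in A' -> y \in B' -> ~~ adj G x y) /\
    [set x | x \notin s'] = A' :|: B'].
  move=> yB sy.
  have cB := cardsD1 y B; rewrite yB in cB.
  apply: (IH (y :: s) A (B :\ y)) => //=.
  - by rewrite /=; lia.
  - by rewrite (disjointFr dBs yB).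
  - move=> x; rewrite !inE; have := cov x.
    by case: (x == y); rewrite ?orbT //=.
  - by rewrite (disjointWr _ dAB) ?subD1set.
  - rewrite disjoint_sym disjoint_cons (disjointFl dAB yB) /=.
    by rewrite disjoint_sym.
  - rewrite disjoint_sym disjoint_cons !inE eqxx /= disjoint_sym.
    by rewrite (disjointWl _ dBs) ?subD1set.
  - by move=> x z xA; rewrite !inE => /andP[_]; apply: noE.
  - lia.
case: s us ss cov dAs dBs leN push => [|x s] us ss cov dAs dBs leN push.
  have /card_gt0P[y yB] : 0 < #|B| by lia.
  exact: push yB _.
case: (pickP (fun y => (y \in B) && adj G x y)) => [y /andP[yB xy]|none].
  by apply: (push y yB) => /=; rewrite adj_sym xy.
(* The top [x] of the stack has no neighbour in [B], so moving it to [A] keeps [A] and [B] without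
   edges between them. *)
move: dAs dBs; rewrite ![[disjoint _ & x :: s]]disjoint_sym !disjoint_cons.
move=> /andP[xA dAs] /andP[xB dBs]; have /andP[xs us'] := us.
apply: (IH s (x |: A) B) => //.
- by move: leN; rewrite /=; lia.
- exact: path_sorted ss.
- move=> z; have := cov z; rewrite !inE.
  by case: (z == x); rewrite ?orbT //=.
- apply/pred0P => z /=; rewrite !inE; case: eqP => [->|_] /=.
    exact: negPf xB.
  by have /pred0P/(_ z) := dAB.
- apply/pred0P => z /=; rewrite !inE; case: eqP => [->|_] /=.
    exact: negPf xs.
  by have /pred0P/(_ z) := dAs; rewrite /= andbC.
- by rewrite disjoint_sym.
- move=> z y; rewrite !inE => /orP[/eqP ->|zA] yB; last exact: noE.
  by have := none y; rewrite yB /= => ->.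
- by rewrite cardsU1 xA; lia.
Qed.

End GraphLemmas.

(** * Random subsets *)

Section RandomSubset.
Import mathcomp.boot.finset mathcomp.boot.fintype.
Local Open Scope ring_scope.
Variables (R : realType) (I : finType).
Implicit Types (E D G H J S : {set I}) (p q r : R) (f g : {set I} -> R).

Definition weight E p G : R := \prod_(e in E) (if e \in G then p else 1 - p).

Definition expect E p f : R := \sum_(G : {set I} | G \subset E) weight E p G * f G.

Definition prob E p (A : pred {set I}) : R := expect E p (fun G => (A G)%:R).

Lemma eq_expect E p f g : (forall G, G \subset E -> f G = g G) ->
  expect E p f = expect E p g.
Proof. by move=> fg; apply: eq_bigr => G GE; rewrite fg. Qed.

Lemma expectD E p f g :
  expect E p (fun G => f G + g G) = expect E p f + expect E p g.
Proof. by rewrite -big_split; apply: eq_bigr => G _; rewrite mulrDr. Qed.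

Lemma expectZ E p c f : expect E p (fun G => c * f G) = c * expect E p f.
Proof. by rewrite /expect mulr_sumr; apply: eq_bigr => G _; rewrite mulrCA. Qed.

Lemma expect_sum E p (K : Type) (s : seq K) (Q : pred K) (F : K -> {set I} -> R) :
  expect E p (fun G => \sum_(k <- s | Q k) F k G) =
  \sum_(k <- s | Q k) expect E p (F k).
Proof.
by rewrite /expect exchange_big; apply: eq_bigr => G _; rewrite mulr_sumr.
Qed.

(** Independence of the parts outside and inside [D], as a Fubini formula: subsets of [E] are such
    pairs of parts, and the weights multiply. *)
Lemma expect_split E D p f : D \subset E ->
  expect E p f =
  expect (E :\: D) p (fun H => expect D p (fun J => f (H :|: J))).
Proof.
move=> DE; rewrite /expect.
under [RHS]eq_bigr => H _ do rewrite mulr_sumr.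
rewrite pair_big /=.
rewrite (reindex_onto (fun HJ : {set I} * {set I} => HJ.1 :|: HJ.2)
  (fun G => (G :\: D, G :&: D))) /=; last first.
  by move=> G _; rewrite setUC setID.
have good (H J : {set I}) :
    (H :|: J \subset E) && (((H :|: J) :\: D, (H :|: J) :&: D) == (H, J)) =
    (H \subset E :\: D) && (J \subset D).
  apply/andP/andP => [[HJE /eqP[e1 e2]]|[HED JD]].
    by split; [rewrite -e1 setSD | rewrite -e2 subsetIr].
  have [HE HD] : H \subset E /\ [disjoint H & D] by apply/andP; rewrite -subsetD.
  rewrite subUset HE (fintype.subset_trans JD DE); split=> //; apply/eqP; congr pair.
    rewrite setDUl (setDidPl HD); apply/setUidPl.
    by rewrite subDset (fintype.subset_trans JD) ?subsetUl.
  rewrite setIUl disjoint_setI0 // set0U; exact/setIidPl.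
apply: eq_big => [[H J]|[H J]] /=; first exact: good.
rewrite good => /andP[HED JD].
have [HE HD] : H \subset E /\ [disjoint H & D] by apply/andP; rewrite -subsetD.
rewrite mulrA; congr (_ * _); rewrite /weight (big_setID D) /= mulrC.
rewrite (setIidPr DE); congr (_ * _); apply: eq_bigr => e.
  rewrite !inE => /andP[eD _]; case: (boolP (e \in J)) => [eJ|]; last by rewrite orbF.
  by rewrite (subsetP JD _ eJ) in eD.
by move=> eD; rewrite inE (disjointFl HD eD).
Qed.

Lemma expect0 p f : expect set0 p f = f set0.
Proof.
rewrite /expect (big_pred1 set0) => [|G]; last by rewrite subset0.
by rewrite /weight big_set0 mul1r.
Qed.

Lemma expect1 e p f :
  expect [set e] p f = p * f [set e] + (1 - p) * f set0.
Proof.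
rewrite /expect (bigD1 [set e]) //= (big_pred1 set0) => [|G].
  by rewrite /weight !big_set1 set11 inE.
rewrite subset1; case: (eqVneq G [set e]) => [->|ne] /=; rewrite ?andbT //.
by apply/esym/negbTE/set0Pn; exists e; rewrite set11.
Qed.

Lemma expectS E e p f : e \in E ->
  expect E p f =
  expect (E :\ e) p (fun H => p * f (e |: H) + (1 - p) * f H).
Proof.
move=> eE; rewrite (@expect_split E [set e]) ?sub1set //.
by apply: eq_expect => H _; rewrite expect1 setU0 setUC.
Qed.

Lemma expect_cst E p c : expect E p (fun=> c) = c.
Proof.
have [N] := ubnP #|E|; elim: N E => [//|N IH] E leN.
case: (set_0Vmem E) => [->|[e eE]]; first by rewrite expect0.
rewrite (expectS _ _ eE) -[RHS](IH (E :\ e)); last first.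
  by rewrite (cardsD1 e) eE in leN.
by apply: eq_expect => G _; ring.
Qed.

(** Exposing one element at a time: it is absent from the union exactly when both rounds miss it. *)
Lemma expect_union E p q r f : 1 - p = (1 - q) * (1 - r) ->
  expect E p f = expect E q (fun G1 => expect E r (fun G2 => f (G1 :|: G2))).
Proof.
move=> pqr; have [N] := ubnP #|E|; elim: N E f => [//|N IH] E f leN.
case: (set_0Vmem E) => [->|[e eE]]; first by rewrite !expect0 setU0.
rewrite !(expectS _ _ eE) IH; last by rewrite (cardsD1 e) eE in leN.
apply: eq_expect => G1 _; rewrite !(expectS _ _ eE) -!expectZ -expectD.
apply: eq_expect => G2 _.
rewrite -!setUA [G1 :|: (e |: G2)]setUCA [e |: (e |: _)]setUA setUid.
have -> : p = 1 - (1 - q) * (1 - r) by rewrite -pqr; ring.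
by ring.
Qed.

Lemma expect_avoid E p S : S \subset E ->
  expect E p (fun G => (G :&: S == set0)%:R) = (1 - p) ^+ #|S|.
Proof.
move=> SE; rewrite (expect_split _ _ SE).
rewrite -[RHS](expect_cst (E :\: S) p); apply: eq_expect => H HE.
have /andP[_ HS] : (H \subset E) && [disjoint H & S] by rewrite -subsetD.
rewrite /expect (bigD1 set0) ?sub0set //= big1 => [|J /andP[JS J0]].
  rewrite setU0 disjoint_setI0 // eqxx mulr1 addr0 /weight.
  by under eq_bigr do rewrite inE; rewrite prodr_const.
by rewrite setIUl disjoint_setI0 // set0U (setIidPl JS) (negbTE J0) mulr0.
Qed.

Section Probability.
Variable p : R.
Hypothesis p01 : 0 <= p <= 1.

Lemma weight_ge0 E G : 0 <= weight E p G.
Proof.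
have /andP[p0 p1] := p01.
by apply: prodr_ge0 => e _; case: ifP => _; rewrite ?subr_ge0.
Qed.

Lemma le_expect E f g : (forall G, G \subset E -> f G <= g G) ->
  expect E p f <= expect E p g.
Proof. by move=> fg; apply: ler_sum => G GE; rewrite ler_wpM2l ?weight_ge0 ?fg. Qed.

Lemma prob_union_bound E (K : finType) (Q : pred K) (A : pred {set I})
    (B : K -> pred {set I}) :
  (forall G, G \subset E -> A G -> exists2 k, Q k & B k G) ->
  prob E p A <= \sum_(k | Q k) prob E p (B k).
Proof.
move=> AB; rewrite -expect_sum; apply: le_expect => G GE.
case: (boolP (A G)) => [AG|_]; last by apply: sumr_ge0.
have [k Qk BkG] := AB G GE AG.
by rewrite (bigD1 k) //= BkG lerDl sumr_ge0.
Qed.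

Lemma prob_or E (A B C : pred {set I}) :
  (forall G, G \subset E -> A G -> B G || C G) ->
  prob E p A <= prob E p B + prob E p C.
Proof.
move=> ABC; rewrite -expectD; apply: le_expect => G GE.
case: (boolP (A G)) => [AG|_]; last by rewrite addr_ge0.
by have /orP[] := ABC G GE AG => ->; rewrite ?lerDl ?lerDr.
Qed.

(* Conditionally on the elements outside [D], the set to be avoided is fixed
   and its elements are still unexposed. *)
Lemma prob_avoid E D (S : {set I} -> {set I}) (m : nat) : D \subset E ->
  (forall G, S G = S (G :\: D)) -> (forall G, S G \subset D) ->
  (forall G, m <= #|S G|)%N ->
  prob E p (fun G => G :&: S G == set0) <= (1 - p) ^+ m.
Proof.
move=> DE S_D SD mS; rewrite /prob (expect_split _ _ DE).
rewrite -[leRHS](expect_cst (E :\: D) p); apply: le_expect => H HE.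
have /andP[_ HD] : (H \subset E) && [disjoint H & D] by rewrite -subsetD.
have -> : expect D p (fun J => ((H :|: J) :&: S (H :|: J) == set0)%:R) =
          expect D p (fun J => (J :&: S H == set0)%:R).
  apply: eq_expect => J JD; congr ((_ == _)%:R).
  have -> : S (H :|: J) = S H.
    rewrite S_D setDUl (setDidPl HD); congr S; apply/setUidPl.
    by rewrite subDset (fintype.subset_trans JD) ?subsetUl.
  by rewrite setIUl disjoint_setI0 ?set0U // (disjointWr (SD H)).
have /andP[p0 p1] := p01.
by rewrite expect_avoid // ler_wiXn2l ?subr_ge0 // gerBl.
Qed.

End Probability.
End RandomSubset.

(** * Greedy matchings in a random graph *)

Section RandomGraph.
Import mathcomp.boot.finset mathcomp.boot.fintype.
Local Open Scope ring_scope.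
Variables (R : realType) (T : finType) (p : R).
Hypothesis p01 : 0 <= p <= 1.
Implicit Types (G : {set {set T}}) (s : seq T).

Definition star (u : T) (V : {set T}) : {set {set T}} := [set [set u; v] | v in V].

Lemma star_pairs u (V : {set T}) : u \notin V -> star u V \subset pairs T.
Proof.
move=> uV; apply/subsetP => _ /imsetP[v vV ->]; rewrite inE cards2.
by have -> : u != v by apply: contraNneq uV => ->.
Qed.

Lemma card_star u (V : {set T}) : u \notin V -> #|star u V| = #|V|.
Proof.
move=> uV; apply: card_in_imset => v w vV wV e.
have : v \in [set u; w] by rewrite -e set22.
by rewrite !inE => /orP[/eqP vu|/eqP //]; rewrite -vu vV in uV.
Qed.

Definition matched_into (us s : seq T) (f : T -> T) G : bool :=
  [forall x in us, (f x \in s) && adj G x (f x)] && dinjectiveb f [in us].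

Lemma matched_intoP us s f G : reflect
  ({in us &, injective f} /\ forall x, x \in us -> (f x \in s) && adj G x (f x))
  (matched_into us s f G).
Proof.
apply: (iffP andP) => [[/forall_inP h1 /dinjectiveP h2]|[h1 h2]]; split => //.
  exact/forall_inP.
exact/dinjectiveP.
Qed.

Definition matchable (us s : seq T) G : bool :=
  [exists f : {ffun T -> T}, matched_into us s f G].

(* Choose partners greedily; the edges at [u] are independent of the choices
   made for [us]. *)
Lemma prob_not_matchable (us s : seq T) (m : nat) :
  uniq us -> uniq s -> (forall x, x \in us -> x \notin s) ->
  (m + size us <= size s)%N ->
  prob (pairs T) p (fun G => ~~ matchable us s G) <=
    (size us)%:R * (1 - p) ^+ m.
Proof.
move=> + uniqs.
elim: us => [|u us IH] /= us_uniq us_s le_s.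
  rewrite mul0r -[leRHS](expect_cst (pairs T) p) le_expect // => G _.
  suff -> : matchable [::] s G by [].
  by apply/existsP; exists [ffun x => x]; apply/matched_intoP.
have /andP[u_us uniq_us] := us_uniq.
have u_s : u \notin s by apply: us_s; rewrite mem_head.
pose V := [set x in s].
have cardV : #|V| = size s by rewrite cardsE; exact/card_uniqP.
have uV : u \notin V by rewrite inE.
pose D := star u V.
(* The partners of [us] are read off [G :\: D], so they do not depend on the edges from [u] to the
   path. The default [set0] keeps the bound on the number of free vertices valid when [us] cannot be
   matched. *)
pose used G : {set T} := if [pick f : {ffun T -> T} | matched_into us s f (G :\: D)]
  is Some f then [set f x | x in us] else set0.
pose S G := star u (V :\: used G).
rewrite -natr1 mulrDl mul1r.
apply: le_trans (lerD (IH uniq_us _ _) (lexx _)); first last.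
- lia.
- by move=> x xus; apply: us_s; rewrite in_cons xus orbT.
apply: le_trans (lerD (lexx _) (@prob_avoid _ _ p p01 (pairs T) D S m _ _ _ _)); first last.
- move=> G; rewrite card_star; last by rewrite inE negb_and uV orbT.
  have cu : (#|used G| <= size us)%N.
    rewrite /used; case: pickP => [f _|_]; last by rewrite cards0.
    exact: leq_trans (leq_imset_card _ _) (card_size _).
  rewrite cardsD cardV; have := subset_leq_card (subsetIr V (used G)); lia.
- by move=> G; apply: imsetS; exact: subsetDl.
- by move=> G; rewrite /S /used setDDl setUid.
- exact: star_pairs.
apply: prob_or => // G GE; apply: contraR; rewrite negb_or negbK.
move=> /andP[/existsP[f fP] /set0Pn[e]]; rewrite inE => /andP[eG eS].
(* Edges at [us] avoid [D], so matchings of [us] in [G :\: D] and in [G] are the same. *)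
have xD x y : x \in us -> [set x; y] \in D = false.
  move=> xus; apply/imsetP => -[v vV e2].
  have : x \in [set u; v] by rewrite -e2 set21.
  rewrite !inE => /orP[] /eqP xv; first by rewrite -xv xus in u_us.
  by move: vV; rewrite -xv inE; apply/negP; apply: us_s; rewrite in_cons xus orbT.
have GD h : matched_into us s h (G :\: D) = matched_into us s h G.
  congr (_ && _); apply: eq_forallb_in => x xus.
  by rewrite /adj inE xD.
move: eS; rewrite /S /used; case: pickP => [h|/(_ f)]; last by rewrite GD fP.
rewrite GD => /matched_intoP[h_inj hP] /imsetP[v + eE].
rewrite !inE => /andP[vh vs]; rewrite eE in eG.
apply/existsP; exists [ffun x => if x == u then v else h x].
have neu x : x \in us -> (x == u) = false.
  by move=> xus; apply/eqP => xu; rewrite -xu xus in u_us.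
have vhx x : x \in us -> v <> h x.
  by move=> xus vE; case/negP: vh; rewrite vE; apply: imset_f.
apply/matched_intoP; split=> [x y|x]; rewrite !inE !ffunE.
  case: (eqVneq x u) => [->|xu] /=; case: (eqVneq y u) => [->|yu] //=.
  - by move=> _ yus /vhx; case/(_ yus).
  - by move=> xus _ /esym /vhx; case/(_ xus).
  - exact: h_inj.
case: (eqVneq x u) => [-> _|xu /=]; first by rewrite vs.
exact: hP.
Qed.

End RandomGraph.

(** * Failure probabilities *)

Section FailureBound.
Import mathcomp.boot.finset mathcomp.boot.fintype.
Local Open Scope ring_scope.

Lemma onem_expn_le (R : realType) (x : R) (k : nat) : 0 <= x <= 1 ->
  (1 - x) ^+ k <= expR (- (x * k%:R)).
Proof.
move=> /andP[x0 x1]; rewrite mulrC -mulrN expRM_natl lerXn2r ?nnegrE ?subr_ge0 ?expR_ge0 //.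
exact: expR_ge1Dx.
Qed.

Variables (R : realType) (T : finType).
Implicit Types (G : {set {set T}}) (s : seq T) (A B : {set T}).

Definition edges_between A B : {set {set T}} :=
  [set [set z.1; z.2] | z in setX A B].

Lemma edges_between_pairs A B : [disjoint A & B] ->
  edges_between A B \subset pairs T.
Proof.
move=> AB; apply/subsetP => _ /imsetP[[x y] /setXP[xA yB] ->].
rewrite inE cards2; have -> // : x != y.
by apply: contraTneq yB => <-; rewrite (disjointFr AB xA).
Qed.

Lemma card_edges_between A B : [disjoint A & B] ->
  #|edges_between A B| = (#|A| * #|B|)%N.
Proof.
move=> AB; rewrite card_in_imset ?cardsX // => -[x y] [x' y'] /=.
move=> /setXP[/= xA yB] /setXP[/= x'A y'B] e.
have : x \in [set x'; y'] by rewrite -e set21.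
have : y \in [set x'; y'] by rewrite -e set22.
rewrite !inE => /orP[/eqP yx'|/eqP ->].
  by rewrite -yx' (disjointFl AB yB) in x'A.
by case/orP=> /eqP xE; [rewrite xE|rewrite -xE (disjointFr AB xA) in y'B].
Qed.

Definition balanced (d : R) (AB : {set T} * {set T}) : bool :=
  [&& [disjoint AB.1 & AB.2], #|AB.1| == #|AB.2| & d <= #|AB.1|%:R].

Definition sparse (d : R) G : bool :=
  [exists AB : {set T} * {set T},
    balanced d AB && (G :&: edges_between AB.1 AB.2 == set0)].

(** Union bound: at most [4 ^ #|T|] pairs of sets, for each of which at least [d ^+ 2] potential
    edges must all be absent. *)
Lemma prob_sparse (q d : R) : 0 <= q <= 1 -> 0 <= d ->
  prob (pairs T) q (sparse d) <= 4%:R ^+ #|T| * expR (- (q * d ^+ 2)).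
Proof.
move=> q01 d0; have /andP[q0 q1] := q01.
apply: (@le_trans _ _ (\sum_(AB : {set T} * {set T} | balanced d AB)
    prob (pairs T) q (fun G => G :&: edges_between AB.1 AB.2 == set0))).
  apply: prob_union_bound => // G _ /existsP[AB /andP[bal nil]].
  by exists AB.
apply: (@le_trans _ _ (\sum_(AB : {set T} * {set T}) expR (- (q * d ^+ 2)))).
  rewrite big_mkcond; apply: ler_sum => -[A B] _ /=.
  case: ifP => [/and3P[/= AB /eqP cAB dA]|_]; last exact: expR_ge0.
  rewrite /prob expect_avoid ?edges_between_pairs // card_edges_between //.
  apply: le_trans (onem_expn_le _ q01) _; rewrite ler_expR lerN2.
  by rewrite ler_wpM2l // -cAB natrM -expr2 lerXn2r ?nnegrE.
have card_sets : #|{: {set T}}| = (2 ^ #|T|)%N.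
  by have := card_powerset [set: T]; rewrite powersetT !cardsT.
by rewrite sumr_const -[leLHS]mulr_natl card_prod card_sets -expnMn natrX.
Qed.

(** Depth-first search started with every vertex unvisited leaves two sets of equal size [k] off the
    path, without edges between them; [k >= d] would make [G] sparse. *)
Lemma long_path d G : ~~ sparse d G -> exists s, exists2 k : nat,
  [/\ uniq s, sorted (adj G) s & k%:R < d] &
  (size s + 2 * k)%N = #|T| /\ #|[set x | x \notin s]| = (2 * k)%N.
Proof.
move=> dense.
case: (@dfs_balanced_split T G [::] set0 [set: T] isT isT).
- by move=> x; rewrite !inE.
- by rewrite disjoints_subset sub0set.
- by rewrite disjoint_sym disjoint_has.
- by rewrite disjoint_sym disjoint_has.
- by move=> x y; rewrite inE.
- by rewrite cards0.
move=> s [A [B [us ss AB cAB [noE comp]]]].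
have cC : #|[set x | x \notin s]| = (2 * #|A|)%N.
  have := leq_card_setU A B; rewrite AB -cAB comp => -[_ /eqP ->]; lia.
exists s, #|A|; split => //.
  rewrite ltNge; apply: contra dense => dA.
  apply/existsP; exists (A, B); rewrite /balanced /= AB cAB eqxx -cAB dA /=.
  apply/set0Pn => -[e /setIP[+ /imsetP[[x y] /setXP[/= xA yB] eE]]].
  by rewrite eE => xy; have := noE x y xA yB; rewrite /adj xy.
rewrite -cC -(card_uniqP us) -[RHS](cardC (mem s)); congr addn.
by apply: eq_card => x; rewrite !inE.
Qed.

(** The bad event of the second round. It is confined to [k <= 2 * size s], where traces are large;
    longer runs make every meeting certain. *)
Definition short_trace s (k : nat) G : bool :=
  [exists ab : T * T, [&& ab.1 \in s, ab.1 != ab.2, (k <= 2 * size s)%N &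
    G :&: trace s k ab.1 ab.2 == set0]].

Lemma prob_short_trace (r : R) s (k : nat) : 0 <= r <= 1 -> uniq s ->
  prob (pairs T) r (short_trace s k) <=
    #|T|%:R ^+ 2 * expR (- (r * (k%:R / 4%:R))).
Proof.
move=> r01 us; have /andP[r0 r1] := r01.
pose Q (ab : T * T) := [&& ab.1 \in s, ab.1 != ab.2 & (k <= 2 * size s)%N].
apply: (@le_trans _ _ (\sum_(ab | Q ab)
    prob (pairs T) r (fun G => G :&: trace s k ab.1 ab.2 == set0))).
  apply: prob_union_bound => // G _ /existsP[ab /and4P[a_s ab_neq km nil]].
  by exists ab; rewrite // /Q a_s ab_neq.
apply: (@le_trans _ _ (\sum_(ab : T * T) expR (- (r * (k%:R / 4%:R))))).
  rewrite big_mkcond; apply: ler_sum => -[a b] _ /=.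
  case: ifP => [/and3P[/= a_s ab km]|_]; last exact: expR_ge0.
  rewrite /prob expect_avoid ?trace_pairs //.
  apply: le_trans (onem_expn_le _ r01) _; rewrite ler_expR lerN2.
  rewrite ler_wpM2l // ler_pdivrMr ?ltr0n // mulrC -natrM ler_nat.
  exact: card_trace.
by rewrite sumr_const -[leLHS]mulr_natl card_prod natrM expr2.
Qed.

(** [(2 * k).+1] counts two runs of [k] rounds and the swap between them. *)
Definition quickly_acquainted (k : nat) G : bool :=
  connected_graph G && (acquaintance_time R G <= ((2 * k).+1%:R)%:E)%E.

Lemma quickly_acquainted_union G1 G2 s k : G1 \subset pairs T -> G2 \subset pairs T ->
  uniq s -> sorted (adj G1) s -> matchable (enum [predC s]) s G2 ->
  ~~ short_trace s k G2 -> quickly_acquainted k (G1 :|: G2).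
Proof.
move=> GP1 GP2 us ss1 /existsP[f /matched_intoP[f_inj fP]] long.
have GP : G1 :|: G2 \subset pairs T by rewrite subUset GP1.
have ss : sorted (adj (G1 :|: G2)) s.
  by apply: sub_sorted ss1 => x y; apply: adj_sub; exact: subsetUl.
have att : attaches (G1 :|: G2) s f.
  split=> [x y xs ys|x xs]; first by apply: f_inj; rewrite mem_enum.
  have /andP[-> xf] : (f x \in s) && adj G2 x (f x) by apply: fP; rewrite mem_enum.
  by apply: adj_sub xf; exact: subsetUr.
rewrite /quickly_acquainted (attached_connected ss att) /=.
apply: ereal_inf_lbound.
exists (path_rounds s k ++ swap_edges (attach_swap s f) :: path_rounds s k).
  apply: (attached_strategy us ss att) => a b a_s ab.
  case: (leqP k (2 * size s)) => km; last exact: (path_rounds_acquainted us ss att GP).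
  apply: trace_acquainted; apply: contra long => /eqP nil.
  apply/existsP; exists (a, b); rewrite /= a_s ab km /= -subset0 -nil.
  by apply: setSI; exact: subsetUr.
by rewrite size_cat /= !size_mkseq addnS mul2n addnn.
Qed.

Lemma prob_not_quickly_acquainted (p q r d : R) (k : nat) :
  0 <= q <= 1 -> 0 <= r <= 1 -> 1 - p = (1 - q) * (1 - r) ->
  0 <= d -> d * 4%:R <= #|T|%:R ->
  prob (pairs T) p (fun G => ~~ quickly_acquainted k G) <=
    4%:R ^+ #|T| * expR (- (q * d ^+ 2)) +
    (#|T|%:R * expR (- (r * (#|T|%:R - 4%:R * d))) +
     #|T|%:R ^+ 2 * expR (- (r * (k%:R / 4%:R)))).
Proof.
move=> q01 r01 pqr d0 dT; have /andP[r0 r1] := r01.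
rewrite /prob (expect_union _ _ pqr).
set c := (X in _ <= _ + X).
have c0 : 0 <= c by rewrite addr_ge0 // mulr_ge0 ?exprn_ge0 ?expR_ge0.
apply: le_trans (lerD (prob_sparse q01 d0) (lexx _)).
rewrite -[c](expect_cst (pairs T) q) /prob -expectD.
apply: le_expect => // G1 GP1.
(* With the first round fixed, a sparse [G1] is paid for by its indicator. Otherwise the path is
   fixed and only the second round can fail. *)
case: (boolP (sparse d G1)) => [_|/long_path[s [h [us ss hd] [sh cs]]]].
  apply: (@le_trans _ _ 1); last by rewrite lerDl.
  rewrite -[leRHS](expect_cst (pairs T) r); apply: le_expect => // G2 _.
  by rewrite lern1 leq_b1.
rewrite add0r.
have size_out : size (enum [predC s]) = (2 * h)%N.
  by rewrite -cardE -cs; apply: eq_card => x; rewrite !inE.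
have hT : (4 * h <= #|T|)%N by rewrite -(ler_nat R) natrM; lra.
apply: le_trans (@prob_or _ _ _ r01 (pairs T) _
  (fun G2 => ~~ matchable (enum [predC s]) s G2) (short_trace s k) _) _.
  move=> G2 GP2; apply: contraR; rewrite negb_or negbK => /andP[mat long].
  exact: (quickly_acquainted_union GP1 GP2 us ss mat long).
apply: lerD; last exact: prob_short_trace.
(* The path has [#|T| - 2 * h] vertices, and at most [2 * h] of them are ever taken as partners. *)
apply: le_trans (@prob_not_matchable _ _ _ r01 _ _ (#|T| - 4 * h)%N _ _ _ _) _.
- exact: enum_uniq.
- by [].
- by move=> x; rewrite mem_enum.
- by rewrite size_out; move: sh hT; clear; lia.
apply: ler_pM; rewrite ?exprn_ge0 ?subr_ge0 ?ler0n //.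
  by rewrite ler_nat size_out; move: hT; clear; lia.
apply: le_trans (onem_expn_le _ r01) _; rewrite ler_expR lerN2 ler_wpM2l //.
by rewrite natrB // natrM; lra.
Qed.

End FailureBound.

Local Open Scope classical_set_scope.
Local Open Scope ring_scope.

(** * Exponents of the three failure terms, with [L] for [ln n] and [N] for [n] *)

Section Exponents.
Variables (F : realFieldType) (e L N p r : F).
Hypotheses (e0 : 0 < e) (e2 : e <= 2^-1) (L0 : 0 < L) (LN : L <= N).
Hypotheses (pN : (1 + e) * L <= p * N) (p0 : 0 < p).
Hypothesis rp : (1 - e / 4%:R) * p <= r.

(** Since [p * N >= L], the subtracted term is at least [4 N]; the remaining [- N] is at most
    [- L]. *)
Lemma sparse_exponent : 4%:R <= L * (e / 4%:R * (e / 16%:R) ^+ 2) ->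
  3%:R * N - e / 4%:R * p * (e / 16%:R * N) ^+ 2 <= - (e / 4%:R * L).
Proof using e0 e2 L0 LN pN.
set c := e / 4%:R * (e / 16%:R) ^+ 2 => Lc.
have c0 : 0 <= c by rewrite mulr_ge0 ?exprn_ge0 ?divr_ge0 ?(ltW e0).
have -> : e / 4%:R * p * (e / 16%:R * N) ^+ 2 = p * N * c * N.
  by rewrite /c; ring.
have LpN : L <= p * N.
  by apply: le_trans pN; rewrite mulrDl mul1r lerDl mulr_ge0 ?ltW.
have : 4%:R * N <= p * N * c * N.
  by rewrite ler_wpM2r ?(le_trans (ltW L0)) // (le_trans Lc) // ler_wpM2r.
have : e * L <= 2^-1 * L by rewrite ler_wpM2r ?(ltW L0).
move: (p * N * c * N) LN L0 => M; lra.
Qed.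

(** One factor [1 - e / 4] is lost in [r], another in the number of free path vertices;
    [(1 - e / 4)^2 (1 + e) >= 1 + e / 4] for [e <= 1/2] shows that the surplus in [p] covers
    both. *)
Lemma match_exponent :
  L - r * (N - 4%:R * (e / 16%:R * N)) <= - (e / 4%:R * L).
Proof using e0 e2 L0 LN pN rp.
have -> : N - 4%:R * (e / 16%:R * N) = (1 - e / 4%:R) * N by field.
have N0 : 0 < N by exact: lt_le_trans LN.
have c0 : 0 <= 1 - e / 4%:R by move: e2; lra.
have : (1 - e / 4%:R) * p * ((1 - e / 4%:R) * N) <= r * ((1 - e / 4%:R) * N).
  by rewrite ler_wpM2r // mulr_ge0 ?(ltW N0).
have : (1 - e / 4%:R) ^+ 2 * ((1 + e) * L) <= (1 - e / 4%:R) ^+ 2 * (p * N).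
  by rewrite ler_wpM2l ?sqr_ge0.
have : (1 + e / 4%:R) * L <= (1 - e / 4%:R) ^+ 2 * (1 + e) * L.
  rewrite ler_wpM2r ?(ltW L0) // -subr_ge0.
  have -> : (1 - e / 4%:R) ^+ 2 * (1 + e) - (1 + e / 4%:R) =
            e * ((4%:R - 7%:R * e) / 16%:R + e ^+ 2 / 16%:R).
    by field.
  have := sqr_ge0 e; move=> ?; apply: mulr_ge0; first exact: ltW.
  move: e2; lra.
lra.
Qed.

(** As [r >= 7 p / 8], the subtracted term is at least [7 L / 2], against [2 L] for the choice of
    two agents. *)
Lemma trace_exponent (k : F) : 0 <= k -> 16%:R * L <= k * p ->
  2%:R * L - r * (k / 4%:R) <= - (e / 4%:R * L).
Proof using e0 e2 L0 p0 rp.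
move=> k0 kL.
have : (1 - e / 4%:R) * p * k <= r * k by rewrite ler_wpM2r.
have : e * (k * p) <= 2^-1 * (k * p) by rewrite ler_wpM2r // mulr_ge0 ?(ltW p0).
have : e * L <= 2^-1 * L by rewrite ler_wpM2r ?(ltW L0).
move: kL L0; lra.
Qed.

End Exponents.

(** Solving for [r] gives [p = q + r - q r <= q + r], whence the lower bound on [r]. *)
Lemma second_round (F : realFieldType) (p q : F) : 0 <= q -> q <= p ->
  p <= 1 -> q < 1 -> exists2 r : F,
  [/\ p - q <= r, 0 <= r & r <= 1] & 1 - p = (1 - q) * (1 - r).
Proof.
move=> q0 qp p1; rewrite -subr_gt0 => q1.
have qne := lt0r_neq0 q1.
have h : p - q <= 1 - (1 - p) / (1 - q).
  suff : (1 - p) / (1 - q) <= 1 - p + q by lra.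
  rewrite ler_pdivrMr // -subr_ge0.
  have -> : (1 - p + q) * (1 - q) - (1 - p) = q * (p - q) by ring.
  by rewrite mulr_ge0 ?subr_ge0.
exists (1 - (1 - p) / (1 - q)); last by rewrite subKr mulrC divfK.
split => //; first by apply: le_trans h; rewrite subr_ge0.
by rewrite gerBl divr_ge0 ?subr_ge0 // -subr_ge0 ltW.
Qed.

(** * Choice of parameters and passage to the limit *)

Section Asymptotics.
Variable R : realType.

Lemma near_ln_ge (M : R) : \forall n \near \oo, M <= ln n%:R.
Proof.
exists (Num.truncn (expR M)).+1 => // n /= nM.
have expM : expR M <= n%:R.
  apply: ltW; apply: lt_le_trans (_ : (Num.truncn (expR M)).+1%:R <= _).
    by have /andP[] := truncn_itv (expR_ge0 M).
  by rewrite ler_nat.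
rewrite -[leLHS]expRK ler_ln // posrE ?expR_gt0 //.
exact: lt_le_trans (expR_gt0 M) expM.
Qed.

Lemma gnp_probE (n : nat) (p : R) (A : pred {set {set 'I_n}}) :
  gnp_prob p A = prob (pairs 'I_n) p A.
Proof.
rewrite /gnp_prob /prob /expect big_mkcondr; apply: eq_bigr => G _.
by case: (A G); rewrite ?mulr1 ?mulr0.
Qed.

Lemma probC (I : finType) (E : {set I}) (p : R) (A : pred {set I}) :
  prob E p A = 1 - prob E p (predC A).
Proof.
apply/eqP; rewrite eq_sym subr_eq -expectD -[X in X == _](expect_cst E p).
by apply/eqP/eq_expect => G _ /=; case: (A G); rewrite ?addr0 ?add0r.
Qed.

Lemma failure_bound (e p : R) (n : nat) : 0 < e -> e <= 2^-1 ->
  (1 + e) * ln n%:R / n%:R <= p -> p <= 1 ->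
  4%:R / (e / 4%:R * (e / 16%:R) ^+ 2) <= ln n%:R -> 1 <= ln n%:R :> R ->
  prob (pairs 'I_n) p (fun G => ~~ (connected_graph G &&
    (acquaintance_time R G <= (40%:R * (ln n%:R / p))%:E)%E)) <=
  3%:R * expR (- (e / 4%:R * ln n%:R)).
Proof.
move=> e0 e2; set L := ln n%:R; set N := n%:R => pL p1 eL L1.
have L0 : 0 < L by exact: lt_le_trans L1.
have n0 : (0 < n)%N.
  by rewrite lt0n; apply: contraTneq L0 => n0; rewrite /L n0 ln0 ?ltxx.
have N0 : 0 < N by rewrite ltr0n.
have LN : L <= N by apply: ltW; exact: ln_sublinear.
have pN : (1 + e) * L <= p * N by rewrite -ler_pdivrMr.
have p0 : 0 < p.
  rewrite -(pmulr_lgt0 _ N0); apply: lt_le_trans pN.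
  by rewrite mulr_gt0 // addr_gt0.
have Lp : 1 <= L / p by rewrite ler_pdivlMr // mul1r (le_trans p1).
pose q := e / 4%:R * p.
have q0 : 0 <= q by rewrite mulr_ge0 ?divr_ge0 ?(ltW e0) ?(ltW p0).
have qp : q <= 8%:R^-1 * p by rewrite ler_wpM2r ?(ltW p0) //; move: e2; clear; lra.
have q1 : q < 1 by move: qp p1 p0; clear; lra.
have [|r [rpq r0 r1] pqr] := second_round q0 _ p1 q1.
  by move: qp p0; clear; lra.
have rp : (1 - e / 4%:R) * p <= r by rewrite mulrBl mul1r.
pose d := e / 16%:R * N.
have d0 : 0 <= d by rewrite mulr_ge0 ?divr_ge0 ?(ltW e0) ?(ltW N0).
(* Rounding up costs at most one, so [2 k + 1 <= 32 L / p + 3], which [L / p >= 1] brings below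
   [40 L / p]. *)
pose k := (Num.truncn (16%:R * (L / p))).+1.
have /andP[k_le k_ge] : (k%:R - 1 <= 16%:R * (L / p)) && (16%:R * (L / p) <= k%:R).
  have : 0 <= 16%:R * (L / p) by rewrite mulr_ge0 // (le_trans _ Lp).
  move/truncn_itv; rewrite /k -[(Num.truncn _).+1%:R]natr1 addrK.
  by move=> /andP[-> /ltW ->].
have kL : 16%:R * L <= k%:R * p by rewrite -ler_pdivrMr // -mulrA.
apply: (@le_trans _ _ (prob (pairs 'I_n) p (fun G => ~~ quickly_acquainted R k G))).
  apply: le_expect => [|G _]; first by rewrite (ltW p0).
  rewrite ler_nat; case: (boolP (quickly_acquainted R k G)); last first.
    by rewrite leq_b1.
  case/andP=> -> quick; rewrite (le_trans quick) //.
  by rewrite lee_fin -natr1 natrM; move: k_le Lp; clear; lra.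
apply: le_trans (@prob_not_quickly_acquainted R 'I_n p q r d k _ _ pqr d0 _) _.
- by rewrite q0 ltW.
- by rewrite r0.
- have : e * N <= 2^-1 * N by rewrite ler_wpM2r ?(ltW N0).
  by rewrite card_ord -/N /d; move: N0; clear; lra.
rewrite card_ord -/N.
have NE : N = expR L by rewrite lnK // posrE.
set x := expR (- (e / 4%:R * L)).
have x_sparse : 4%:R ^+ n * expR (- (q * d ^+ 2)) <= x.
  (* This is the source of [3 N] in [sparse_exponent]: [4 ^ n <= exp (3 n)]. *)
  have le4 : 4%:R <= expR 3%:R :> R.
    by apply: le_trans (expR_ge1Dx _); clear; lra.
  apply: (@le_trans _ _ (expR 3%:R ^+ n * expR (- (q * d ^+ 2)))).
    by rewrite ler_wpM2r ?expR_ge0 // lerXn2r ?nnegrE ?expR_ge0.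
  rewrite -expRM_natl -expRD ler_expR -/N [N * _]mulrC.
  apply: (sparse_exponent e0 e2 L0 LN pN).
  by rewrite -ler_pdivrMr // mulr_gt0 ?exprn_gt0 ?divr_gt0.
have x_match : N * expR (- (r * (N - 4%:R * d))) <= x.
  by rewrite {1}NE -expRD ler_expR (match_exponent e0 e2 L0 LN pN rp).
have x_trace : N ^+ 2 * expR (- (r * (k%:R / 4%:R))) <= x.
  rewrite NE -expRM_natl -expRD ler_expR.
  exact: (trace_exponent e0 e2 L0 p0 rp (ler0n _ _) kL).
by move: x_sparse x_match x_trace; clear; lra.
Qed.

End Asymptotics.

Theorem theorem1p1 (R : realType) (eps : R) (eps_gt0 : 0 < eps) :
  exists2 C : R, 0 < C &
    forall p : nat -> R,
      (\forall n \near \oo,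
         (1 + eps) * ln n%:R / n%:R <= p n /\ p n <= 1 - eps) ->
      gnp_prob (p n) (fun G : {set {set 'I_n}} =>
        connected_graph G &&
        (acquaintance_time R G <= (C * (ln n%:R / p n))%:E)%E)
      @[n --> \oo] --> (1 : R).
Proof.
exists 40%:R => // p p_bounds.
(* The exponent estimates require [e <= 1/2]; lowering [eps] only weakens the lower bound on [p]. *)
pose e := Num.min eps 2^-1.
have e0 : 0 < e by rewrite lt_min eps_gt0 invr_gt0 ltr0n.
have e2 : e <= 2^-1 by rewrite ge_min lexx orbT.
have e_eps : e <= eps by rewrite ge_min lexx.
apply/cvgrPdist_le => eta eta0.
have eL := near_ln_ge (4%:R / (e / 4%:R * (e / 16%:R) ^+ 2)).
have L1 := near_ln_ge (1 : R).
(* Chosen so that [y = e / 4 * ln n] satisfies [3 <= eta * y]; then [3 exp(- y) <= eta] because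
   [exp y >= y]. *)
have etaL := near_ln_ge (12%:R / (e * eta)).
near=> n.
have [pL p1] : (1 + eps) * ln n%:R / n%:R <= p n /\ p n <= 1 - eps by near: n.
have L1n : 1 <= ln n%:R :> R by near: n.
have eLn : 4%:R / (e / 4%:R * (e / 16%:R) ^+ 2) <= ln n%:R by near: n.
have pn1 : p n <= 1 by move: p1 eps_gt0; clear; lra.
have etaLn : 12%:R / (e * eta) <= ln n%:R by near: n.
have pL' : (1 + e) * ln n%:R / n%:R <= p n.
  apply: le_trans pL; rewrite ler_wpM2r ?invr_ge0 // ler_wpM2r ?lerD2l //.
  exact: le_trans L1n.
have p0 : 0 <= p n.
  by apply: le_trans pL'; rewrite divr_ge0 // mulr_ge0 ?(le_trans ler01 L1n) // addr_ge0 ?ltW.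
rewrite gnp_probE probC opprB addrC subrK ger0_norm; last first.
  rewrite -[leLHS](expect_cst (pairs 'I_n) (p n)); apply: le_expect => [|G _].
    by rewrite p0.
  exact: ler0n.
apply: le_trans (failure_bound e0 e2 pL' pn1 eLn L1n) _.
set y := e / 4%:R * ln n%:R.
have y_eta : 3%:R <= eta * y.
  by move: etaLn; rewrite ler_pdivrMr ?mulr_gt0 // /y; clear; lra.
have y0 : 0 <= y by rewrite mulr_ge0 ?divr_ge0 ?(ltW e0) // (le_trans ler01).
rewrite expRN ler_pdivrMr ?expR_gt0 //; apply: le_trans y_eta _.
rewrite ler_wpM2l ?(ltW eta0) //; apply: le_trans (expR_ge1Dx y).
by rewrite lerDr.
Unshelve. all: by end_near.
Qed.
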